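(* Let $\mathcal{C}$ be a family of ILS cuts and let $\mathcal{F}'$ be the feasible region of the formulation $\mathrm{ILS}(\mathcal{X},\mathcal{C},\Omega)$, that is, $$\mathcal{F}'=\{(x,\theta)\in(\mathcal{X}\cap\mathbb{Z}^E)\times\mathbb{R}^\Omega_+ : \theta(U)\ge \mathcal{L}(U,\mathcal{X}')\cdot(\alpha^{T}x+\beta)\ \ \forall (U,\mathcal{X}',\mathcal{L}(U,\mathcal{X}'),\alpha,\beta)\in\mathcal{C}\}.$$ Then the following holds: (i) $\mathcal{F}(\mathcal{Q},\mathcal{X},\Omega)\subseteq\mathcal{F}'$; and (ii) $\mathrm{epi}(\mathcal{Q},\mathcal{X})=\mathrm{proj}_{(x,\rho)}(\mathcal{F}')$ if and only if $\mathbf{1}^{T}\bar\theta\ge\mathcal{Q}(\bar x)$ for all $(\bar x,\bar\theta)\in\mathcal{F}'$.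
   Context: Setting. $G=(V,E)$ is a complete undirected graph with $V=\{0\}\,\dot\cup\,V_+$, where $0$ is the depot and $V_+$ is the finite set of customers. For $S\subseteq V$, $E(S)$ is the set of edges with both endpoints in $S$ and $\delta(S)$ the set of edges with exactly one endpoint in $S$ ($\delta(v)=\delta(\{v\})$). For a vector $f$ and a set $H$ of coordinates, $f(H)=\sum_{i\in H}f_i$. A route is a simple cycle through the depot, written $R=(v_1,\dots,v_\ell)$ with $\ell\ge1$ and distinct customers $v_i$, with edges $0v_1,v_1v_2,\dots,v_\ell0$ (edge $0v_1$ taken with multiplicity 2 if $\ell=1$); a sequence and its reversal are the same route. $V_+(R)=\{v_1,\dots,v_\ell\}$, and $\mathbb{1}_R\in\mathbb{Z}^E$ is the characteristic vector of the edge (multi)set of $R$. A routing plan is a set of routes whose customer sets partition $V_+$. Let $$\mathcal{X}_{\mathrm{sub}}=\{x\in[0,2]^E : x(\delta(v))=2\ \forall v\in V_+,\ x(E(S))\le|S|-1\ \forall\,\emptyset\ne S\subseteq V_+\}.$$ Integer vectors $x\in\mathcal{X}_{\mathrm{sub}}$ are in bijection with routing plans; $\mathcal{R}(x)$ denotes the unique routing plan with $x=\sum_{R\in\mathcal{R}(x)}\mathbb{1}_R$. Fix a polytope $\mathcal{X}\subseteq\mathcal{X}_{\mathrm{sub}}$. A recourse function $\mathcal{Q}$ (fixed) assigns to each route $R$ a value $\mathcal{Q}(R)\in\mathbb{Q}_+$; for $x\in\mathcal{X}\cap\mathbb{Z}^E$, $\mathcal{Q}(x)=\sum_{R\in\mathcal{R}(x)}\mathcal{Q}(R)$.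 Define $\mathrm{epi}(\mathcal{Q},\mathcal{X})=\{(x,\rho): \rho\ge\mathcal{Q}(x),\ x\in\mathcal{X}\cap\mathbb{Z}^E\}$. Disaggregation. $\Omega$ is a fixed nonempty finite set, and a disaggregation of $\mathcal{Q}$ along $\Omega$ is fixed: values $\mathcal{Q}(R,\omega)\in\mathbb{Q}_+$ for every route $R$ and $\omega\in\Omega$ with $\mathcal{Q}(R)=\sum_{\omega\in\Omega}\mathcal{Q}(R,\omega)$ for every $\bar x\in\mathcal{X}\cap\mathbb{Z}^E$ and $R\in\mathcal{R}(\bar x)$. Define $$\mathcal{F}(\mathcal{Q},\mathcal{X},\Omega)=\Big\{(x,\theta)\in(\mathcal{X}\cap\mathbb{Z}^E)\times\mathbb{R}^\Omega_+ : \theta_\omega\ge\sum_{R\in\mathcal{R}(x)}\mathcal{Q}(R,\omega)\ \forall\omega\in\Omega\Big\}.$$ For $P\subseteq\mathbb{R}^E\times\mathbb{R}^\Omega$, $\mathrm{proj}_{(x,\rho)}(P)=\{(x,\rho):\rho=\mathbf{1}^T\theta,\ (x,\theta)\in P\}$, where $\mathbf{1}$ is the all-ones vector. ILS cuts. For $\mathcal{X}'\subseteq\mathcal{X}\cap\mathbb{Z}^E$, an activation function with respect to $\mathcal{X}'$ is an affine function $W(\cdot;\mathcal{X}'):\mathbb{R}^E\to\mathbb{R}$ with $W(x;\mathcal{X}')=1$ for $x\in\mathcal{X}'$ and $W(x;\mathcal{X}')\le0$ for $x\in(\mathcal{X}\cap\mathbb{Z}^E)\setminus\mathcal{X}'$.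 For $U\subseteq\Omega$, a number $\mathcal{L}(U,\mathcal{X}')\in\mathbb{Q}_+$ is a recourse lower bound with respect to $U$ and $\mathcal{X}'$ if $\sum_{\omega\in U}\sum_{R\in\mathcal{R}(\bar x)}\mathcal{Q}(R,\omega)\ge\mathcal{L}(U,\mathcal{X}')$ for all $\bar x\in\mathcal{X}'$. An ILS cut is an inequality $\theta(U)\ge\mathcal{L}(U,\mathcal{X}')\cdot W(x;\mathcal{X}')$ with $U\subseteq\Omega$, $\mathcal{X}'\subseteq\mathcal{X}\cap\mathbb{Z}^E$, $\mathcal{L}(U,\mathcal{X}')$ a recourse lower bound and $W(\cdot;\mathcal{X}')$ an activation function. A family of ILS cuts is a set $\mathcal{C}$ of tuples $(U,\mathcal{X}',\mathcal{L}(U,\mathcal{X}'),\alpha,\beta)$ such that $\theta(U)\ge\mathcal{L}(U,\mathcal{X}')\cdot(\alpha^Tx+\beta)$ is an ILS cut (so $x\mapsto\alpha^Tx+\beta$ is an activation function with respect to $\mathcal{X}'$). *)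

(* Defs.v *)
From HB Require Import structures.
From mathcomp Require Import all_boot all_order all_algebra generic_quotient.
From mathcomp Require Import archimedean.
From mathcomp Require Import boolp classical_sets reals.

Set Implicit Arguments.
Unset Strict Implicit.
Unset Printing Implicit Defensive.

Import Order.TTheory GRing.Theory Num.Theory.
Local Open Scope ring_scope.

(* The customers are the elements of a finite type C. The vertices are the
   elements of [option C], where [None] is the depot and [Some v] the
   customer v. *)

Definition edge (C : finType) : predArgType :=
  {e : {set option C} | #|e| == 2%N}.
HB.instance Definition _ (C : finType) := Finite.on (edge C).

Definition inner_edges (C : finType) (S : {set option C}) : {set edge C} :=
  [set e : edge C | val e \subset S].

Definition cut_edges (C : finType) (S : {set option C}) : {set edge C} :=
  [set e : edge C | #|val e :&: S| == 1%N].

Definition vsum (R : realType) (I : finType) (f : {ffun I -> R}) (H : {set I})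
  : R := \sum_(i in H) f i.

(* A route is given by its nonempty duplicate-free sequence of customers,
   modulo reversal. The bound on the length follows from the absence of
   duplicates and only serves to obtain a finite type. *)

Definition route_seq (C : finType) : predArgType :=
  {s : #|C|.-bseq C | (uniq s) && (s != [::] :> seq C)}.
HB.instance Definition _ (C : finType) := Finite.on (route_seq C).

Definition customers_of (C : finType) (s : route_seq C) : seq C :=
  bseqval (val s).

Definition same_route (C : finType) : rel (route_seq C) := fun s t =>
  (customers_of s == customers_of t) || (customers_of s == rev (customers_of t)).

Lemma same_route_refl C : reflexive (@same_route C).
Proof. by move=> s; rewrite /same_route eqxx. Qed.

Lemma same_route_sym C : symmetric (@same_route C).
Proof.
move=> s t; rewrite /same_route eq_sym; congr (_ || _).
by apply/eqP/eqP => ->; rewrite revK.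
Qed.

Lemma same_route_trans C : transitive (@same_route C).
Proof.
move=> t s u /orP[]/eqP st /orP[]/eqP tu; rewrite /same_route st tu ?revK;
  by rewrite eqxx ?orbT.
Qed.

Canonical same_route_equiv (C : finType) :=
  EquivRel (@same_route C) (@same_route_refl C) (@same_route_sym C)
    (@same_route_trans C).

Definition route (C : finType) : predArgType := {eq_quot @same_route C}%qT.
HB.instance Definition _ (C : finType) := EqQuotient.on (route C).
HB.instance Definition _ (C : finType) := [Countable of route C by <:%/].
HB.instance Definition _ (C : finType) :=
  isFinite.Build (route C) (pcan_enumP (can_pcan (@reprK _ (route C)))).

Definition seq_customers (C : finType) (s : route_seq C) : {set C} :=
  [set v in customers_of s].

(* The successive vertex pairs of the closed walk 0, v_1, ..., v_l, 0. *)
Definition seq_steps (C : finType) (s : route_seq C)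
  : seq (option C * option C) :=
  let p := map Some (customers_of s) in zip (None :: p) (rcons p None).

(* For l = 1 the steps (0, v_1) and (v_1, 0) both count, so that the edge
   0v_1 has multiplicity 2. *)
Definition seq_mult (C : finType) (s : route_seq C) (e : edge C) : nat :=
  count (fun uv => [set uv.1; uv.2] == val e) (seq_steps s).

Definition route_customers (C : finType) (r : route C) : {set C} :=
  seq_customers (repr r).

Definition route_mult (C : finType) (r : route C) (e : edge C) : nat :=
  seq_mult (repr r) e.

(* Neither notion depends on the chosen representative. *)
Lemma route_customersE (C : finType) (s : route_seq C) :
  route_customers (\pi_(route C) s)%qT = seq_customers s.
Proof.
rewrite /route_customers; case: piP => t /eqmodP /orP[]/eqP st;
  by apply/setP => v; rewrite !inE st ?mem_rev.
Qed.

Lemma route_multE (C : finType) (s : route_seq C) (e : edge C) :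
  route_mult (\pi_(route C) s)%qT e = seq_mult s e.
Proof.
rewrite /route_mult; case: piP => t /eqmodP /orP[]/eqP st.
  by rewrite /seq_mult /seq_steps st.
rewrite /seq_mult /seq_steps st; set p := map Some (customers_of t).
rewrite map_rev -/p -rev_rcons -rev_cons -rev_zip ?size_rcons // count_rev.
elim: (None :: p) (rcons p None) => [|x a IH] [|y b] //=.
by rewrite IH finset.setUC.
Qed.

Definition char_vec (R : realType) (C : finType) (r : route C)
  : {ffun edge C -> R} := [ffun e => (route_mult r e)%:R].

Definition routing_plan (C : finType) (P : {set route C}) : bool :=
  (\bigcup_(r in P) route_customers r == [set: C])
  && [forall r in P, forall r' in P,
        (r != r') ==> [disjoint route_customers r & route_customers r']].

(* The unique routing plan P with x = sum of the characteristic vectors of the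
   routes in P, which exists for every integer x in [Xsub] below; the default
   value set0 is only reached for other x. *)
Definition plan_of (R : realType) (C : finType) (x : {ffun edge C -> R})
  : {set route C} :=
  odflt finset.set0 [pick P : {set route C} |
    routing_plan P && (x == \sum_(r in P) char_vec R r)].

Local Open Scope classical_set_scope.

Definition Xsub (R : realType) (C : finType) : set {ffun edge C -> R} :=
  [set x : {ffun edge C -> R} | (forall e, 0 <= x e <= 2)
    /\ (forall v : C, vsum x (cut_edges [set Some v]%SET) = 2)
    /\ (forall S : {set C}, S != finset.set0 ->
          vsum x (inner_edges (Some @: S)%SET) <= #|S|%:R - 1)].

(* A bounded set which is the solution set of finitely many linear
   inequalities. *)
Definition polytope (R : realType) (I : finType) (X : set {ffun I -> R})
  : Prop :=
  (exists (m : nat) (A : 'I_m -> {ffun I -> R}) (b : 'I_m -> R),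
     X = [set x : {ffun I -> R} | forall k, \sum_i A k i * x i <= b k])
  /\ (exists M : R, forall x, X x -> forall i, `|x i| <= M).

Definition integer_points (R : realType) (I : finType) (X : set {ffun I -> R})
  : set {ffun I -> R} :=
  X `&` [set x : {ffun I -> R} | forall i, x i \is a Num.int].

Definition plan_cost (R : realType) (C : finType) (q : route C -> rat)
    (x : {ffun edge C -> R}) : R :=
  \sum_(r in plan_of x) ratr (q r).

Definition epi (R : realType) (C : finType) (Q : route C -> rat)
    (X : set {ffun edge C -> R}) : set ({ffun edge C -> R} * R) :=
  [set p : {ffun edge C -> R} * R | plan_cost Q p.1 <= p.2 /\ integer_points X p.1].

Definition disaggregation (R : realType) (C Omega : finType)
    (Q : route C -> rat) (X : set {ffun edge C -> R})
    (QO : route C -> Omega -> rat) : Prop :=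
  (forall r w, 0 <= QO r w)
  /\ (forall x, integer_points X x -> forall r, r \in plan_of x ->
        Q r = \sum_(w : Omega) QO r w).

Definition disaggregated_region (R : realType) (C Omega : finType)
    (X : set {ffun edge C -> R}) (QO : route C -> Omega -> rat)
  : set ({ffun edge C -> R} * {ffun Omega -> R}) :=
  [set p : {ffun edge C -> R} * {ffun Omega -> R} |
     integer_points X p.1
    /\ (forall w, 0 <= p.2 w)
    /\ (forall w, plan_cost (QO^~ w) p.1 <= p.2 w)].

Definition proj_x_rho (R : realType) (I Omega : finType)
    (P : set ({ffun I -> R} * {ffun Omega -> R}))
  : set ({ffun I -> R} * R) :=
  [set p : {ffun I -> R} * R |
     exists theta : {ffun Omega -> R}, p.2 = \sum_(w : Omega) theta w /\ P (p.1, theta)].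

Definition affine_form (R : realType) (I : finType) (alpha : {ffun I -> R})
    (beta : R) (x : {ffun I -> R}) : R :=
  (\sum_i alpha i * x i) + beta.

Definition activation_function (R : realType) (I : finType)
    (X X' : set {ffun I -> R}) (W : {ffun I -> R} -> R) : Prop :=
  (exists alpha beta, W = affine_form alpha beta)
  /\ (forall x, X' x -> W x = 1)
  /\ (forall x, (integer_points X `\` X') x -> W x <= 0).

Definition recourse_lower_bound (R : realType) (C Omega : finType)
    (QO : route C -> Omega -> rat) (U : {set Omega})
    (X' : set {ffun edge C -> R}) (L : rat) : Prop :=
  0 <= L /\ (forall x, X' x -> ratr L <= \sum_(w in U) plan_cost (QO^~ w) x).

Record ils_tuple (R : realType) (C Omega : finType) := IlsTuple {
  ils_U : {set Omega};
  ils_X' : set {ffun edge C -> R};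
  ils_L : rat;
  ils_alpha : {ffun edge C -> R};
  ils_beta : R
}.

Definition is_ils_cut (R : realType) (C Omega : finType)
    (X : set {ffun edge C -> R}) (QO : route C -> Omega -> rat)
    (c : ils_tuple R C Omega) : Prop :=
  ils_X' c `<=` integer_points X
  /\ recourse_lower_bound QO (ils_U c) (ils_X' c) (ils_L c)
  /\ activation_function X (ils_X' c)
       (affine_form (ils_alpha c) (ils_beta c)).

Definition ils_region (R : realType) (C Omega : finType)
    (X : set {ffun edge C -> R}) (cuts : set (ils_tuple R C Omega))
  : set ({ffun edge C -> R} * {ffun Omega -> R}) :=
  [set p : {ffun edge C -> R} * {ffun Omega -> R} |
     integer_points X p.1
    /\ (forall w, 0 <= p.2 w)
    /\ (forall c, cuts c ->
          ratr (ils_L c) * affine_form (ils_alpha c) (ils_beta c) p.1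
            <= vsum p.2 (ils_U c))].

(* Main.v *)
Require Import Defs.
From HB Require Import structures.
From mathcomp Require Import all_boot all_order all_algebra.
From mathcomp Require Import boolp classical_sets reals.
Set Implicit Arguments.
Unset Strict Implicit.
Unset Printing Implicit Defensive.
Import Order.TTheory GRing.Theory Num.Theory.
Local Open Scope classical_set_scope.
Local Open Scope ring_scope.

(** Every ILS cut is valid for the disaggregated region, by cases on whether
    the integer point [x] lies in the set [X'] of the cut. On [X'] the
    activation function is 1 and the cut reduces to the recourse lower bound;
    off [X'] it is nonpositive, so the right-hand side of the cut is
    nonpositive as well and the cut follows from nonnegativity of [theta]
    ([ils_cut_valid]). This gives part (i).

    For part (ii), the disaggregated region already projects onto a superset
    of the epigraph ([epi_sub_proj_disaggregated]): the costs per element of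
    [Omega] add up to the recourse cost, and any surplus in [rho] can be
    charged to one of them. Combined with (i), the inclusion of the epigraph
    in the projection of the ILS region holds for every family of cuts. Hence
    equality amounts to the opposite inclusion, which says precisely that
    the components of [theta] sum to at least the recourse cost. *)

Lemma plan_cost_ge0 (R : realType) (C : finType) (q : route C -> rat)
    (x : {ffun edge C -> R}) :
  (forall r, 0 <= q r) -> 0 <= plan_cost q x.
Proof. by move=> q_ge0; apply: sumr_ge0 => r _; rewrite ler0q. Qed.

Lemma sum_plan_cost (R : realType) (C Omega : finType)
    (Q : route C -> rat) (QO : route C -> Omega -> rat)
    (X : set {ffun edge C -> R}) (x : {ffun edge C -> R}) :
  disaggregation Q X QO -> integer_points X x ->
  \sum_(w : Omega) plan_cost (QO^~ w) x = plan_cost Q x.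
Proof.
move=> [_ QE] Xx; rewrite /plan_cost exchange_big /=.
by apply: eq_bigr => r rx; rewrite (QE x Xx r rx) rmorph_sum.
Qed.

Lemma ils_cut_valid (R : realType) (C Omega : finType)
    (X : set {ffun edge C -> R}) (QO : route C -> Omega -> rat)
    (c : ils_tuple R C Omega) (x : {ffun edge C -> R})
    (theta : {ffun Omega -> R}) :
  is_ils_cut X QO c -> disaggregated_region X QO (x, theta) ->
  ratr (ils_L c) * affine_form (ils_alpha c) (ils_beta c) x
    <= vsum theta (ils_U c).
Proof.
move=> [_ [[L_ge0 LP] [_ [W1 W_le0]]]] [/= Xx [theta_ge0 theta_ge]].
have [X'x|nX'x] := pselect (ils_X' c x).
  rewrite W1 // mulr1; apply: le_trans (LP x X'x) _.
  by apply: ler_sum => w _; apply: theta_ge.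
apply: (@le_trans _ _ 0); last by apply: sumr_ge0 => w _; apply: theta_ge0.
by apply: mulr_ge0_le0; [rewrite ler0q | apply: W_le0].
Qed.

Lemma disaggregated_sub_ils (R : realType) (C Omega : finType)
    (X : set {ffun edge C -> R}) (QO : route C -> Omega -> rat)
    (cuts : set (ils_tuple R C Omega)) :
  (forall c, cuts c -> is_ils_cut X QO c) ->
  disaggregated_region X QO `<=` ils_region X cuts.
Proof.
move=> cutsP [x theta] Fx; case: (Fx) => Xx [theta_ge0 _].
by split=> //; split=> // c /cutsP cP; apply: ils_cut_valid cP Fx.
Qed.

(** The witness above [(x, rho)] gives each element of [Omega] its own cost
    and charges the whole surplus [rho - Q(x)] to a single one of them, which
    is where nonemptiness of [Omega] matters. *)
Lemma epi_sub_proj_disaggregated (R : realType) (C Omega : finType)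
    (X : set {ffun edge C -> R})
    (Q : route C -> rat) (QO : route C -> Omega -> rat) :
  (0 < #|Omega|)%N -> disaggregation Q X QO ->
  epi Q X `<=` proj_x_rho (disaggregated_region X QO).
Proof.
move=> /card_gt0P[w0 _] QO_disagg [x rho] [/= Qx Xx].
pose theta := [ffun w => plan_cost (QO^~ w) x
                         + (if w == w0 then rho - plan_cost Q x else 0)].
have theta_ge w : plan_cost (QO^~ w) x <= theta w.
  by rewrite ffunE lerDl; case: ifP => // _; rewrite subr_ge0.
exists theta; split=> /=.
  under eq_bigr do rewrite ffunE.
  rewrite big_split /= (sum_plan_cost QO_disagg Xx) -big_mkcond big_pred1_eq.
  by rewrite addrC subrK.
split=> //; split=> // w; apply: le_trans (theta_ge w).
by case: QO_disagg => QO_ge0 _; apply: plan_cost_ge0.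
Qed.

Theorem theorem1 (R : realType) (C : finType)
    (X : set {ffun edge C -> R})
    (X_polytope : polytope X) (X_sub : X `<=` @Xsub R C)
    (Q : route C -> rat) (Q_ge0 : forall r, 0 <= Q r)
    (Omega : finType) (Omega_gt0 : (0 < #|Omega|)%N)
    (QO : route C -> Omega -> rat) (QO_disagg : disaggregation Q X QO)
    (cuts : set (ils_tuple R C Omega))
    (cutsP : forall c, cuts c -> is_ils_cut X QO c) :
  disaggregated_region X QO `<=` ils_region X cuts
  /\ (epi Q X = proj_x_rho (ils_region X cuts)
      <-> forall x theta, ils_region X cuts (x, theta) ->
            plan_cost Q x <= \sum_(w : Omega) theta w).
Proof.
have F_sub := disaggregated_sub_ils cutsP.
split=> //; split=> [epiE x theta Fx | cost_le].
  have : proj_x_rho (ils_region X cuts) (x, \sum_w theta w) by exists theta.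
  by rewrite -epiE => -[].
apply/seteqP; split=> [p | [x rho] [theta [/= -> Fx]]].
  move=> /(epi_sub_proj_disaggregated Omega_gt0 QO_disagg) [theta [rhoE Fp]].
  by exists theta; split=> //; apply: F_sub.
by split; [apply: cost_le | case: Fx].
Qed.
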